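(* Let $f(x)=\sum_{j\ge0}a_jx^j$ be real analytic with $a_j\ge0$ for all $j\ge0$ and radius of convergence $R$. Let $1\le k\le n$ and for an $n\times n$ Hermitian positive definite matrix $A$ with spectrum in $(0,R)$ set $\phi(A)=\prod_{i=1}^k f(\lambda_i(A))$, where $\lambda_1(A)\ge\dots\ge\lambda_n(A)$ are the eigenvalues of $A$. Then $\phi$ is log-g-convex on the set of such matrices, i.e., $\phi(A\#B)\le\sqrt{\phi(A)\phi(B)}$ for all such $A,B$.
   Context: For Hermitian positive definite $A,B$, $A\#B:=A^{1/2}(A^{-1/2}BA^{-1/2})^{1/2}A^{1/2}$ (the matrix geometric mean). *)

(* Defs.v *)
From HB Require Import structures.
From Stdlib Require Import ClassicalEpsilon.
From mathcomp Require Import all_boot all_order all_algebra.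
From mathcomp Require Import all_classical all_reals all_analysis.
From mathcomp Require Import complex.

Set Implicit Arguments.
Unset Strict Implicit.
Unset Printing Implicit Defensive.

Import Order.TTheory GRing.Theory Num.Theory numFieldNormedType.Exports.
Local Open Scope ring_scope.
Local Open Scope classical_set_scope.

Section MatrixDefs.
Variables (R : realType) (n : nat).
Local Notation C := (complex R).

Definition adjmx (A : 'M[C]_n) : 'M[C]_n := (map_mx conjc A)^T.

Definition hermitian (A : 'M[C]_n) : Prop := adjmx A = A.

Definition qform (A : 'M[C]_n) (v : 'cV[C]_n) : C :=
  ((map_mx conjc v)^T *m A *m v) 0 0.

Definition hpd (A : 'M[C]_n) : Prop :=
  hermitian A /\ forall v : 'cV[C]_n, v != 0 -> 0 < qform A v.

Definition hpsd (A : 'M[C]_n) : Prop :=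
  hermitian A /\ forall v : 'cV[C]_n, 0 <= qform A v.

Definition sqrtmx (A : 'M[C]_n) : 'M[C]_n :=
  epsilon (inhabits 0) (fun X => hpsd X /\ X *m X = A).

Definition gmean (A B : 'M[C]_n) : 'M[C]_n :=
  let Ah := sqrtmx A in
  let Aih := invmx Ah in
  Ah *m sqrtmx (Aih *m B *m Aih) *m Ah.

Definition is_spectrum (A : 'M[C]_n) (s : seq R) : Prop :=
  size s = n /\ sorted (fun x y : R => y <= x) s /\
  char_poly A = \prod_(x <- s) ('X - (x%:C)%C%:P).

Definition eigs (A : 'M[C]_n) : seq R :=
  epsilon (inhabits [::]) (is_spectrum A).

(* lambda_i(A), 1-based: lambda_1(A) >= ... >= lambda_n(A) *)
Definition lambda (A : 'M[C]_n) (i : nat) : R := nth 0 (eigs A) i.-1.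

End MatrixDefs.

Section PowerSeries.
Variable R : realType.

Definition pseries (a : nat -> R) (x : R) : R :=
  limn (series (fun j => a j * x ^+ j)).

Definition conv_radius (a : nat -> R) : \bar R :=
  ereal_sup [set r%:E | r in
     [set r : R | 0 <= r /\ cvgn (series (fun j => a j * r ^+ j))]].

Definition phi (n k : nat) (a : nat -> R) (A : 'M[complex R]_n) : R :=
  \prod_(1 <= i < k.+1) pseries a (lambda A i).

End PowerSeries.

(* Main.v *)
Require Import Defs.
From mathcomp Require Import all_boot all_order all_fingroup all_algebra.
From mathcomp Require Import all_classical all_reals all_analysis.
From mathcomp Require Import complex ring.

Set Implicit Arguments.
Unset Strict Implicit.
Unset Printing Implicit Defensive.

Import Order.TTheory GRing.Theory Num.Theory numFieldNormedType.Exports.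
Local Open Scope ring_scope.
Local Open Scope sesquilinear_scope.

(* With X = A^(1/2) and S = (X^-1 B X^-1)^(1/2), the mean is G = X S X, so that
   V^* G V = (X V)^* (S X V) for every n x j matrix V, while (X V)^* (X V) = V^* A V
   and (S X V)^* (S X V) = V^* B V.  The Cauchy-Schwarz inequality for determinants
   (Cauchy-Binet) gives det(V^* G V)^2 <= det(V^* A V) det(V^* B V).  If V has
   orthonormal columns, Cauchy-Binet also bounds det(V^* A V) by the product of the
   j largest eigenvalues of A; taking for V the top eigenvectors of G yields
   prod_{i <= j} lambda_i(G)^2 <= prod_{i <= j} lambda_i(A) lambda_i(B) for all j.
   For a polynomial f with nonnegative coefficients, t |-> log f(e^t) is convex and
   nondecreasing, so its tangent slopes at log lambda_i(G) are nonnegative and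
   nonincreasing in i; the tangent inequalities and Abel summation turn the
   log-majorization into the claim for f.  Partial sums and a limit finish. *)

(** * Determinants of Gram matrices *)

Section CauchyBinet.
Variables (R : comNzRingType) (k n : nat) (A : 'M[R]_(k, n)) (B : 'M[R]_(n, k)).

(** Multilinearity in the rows of [A *m B]: in the Leibniz formula, each product of sums expands
    into a sum over all maps [f], and the permutations then reassemble the determinant of
    [rowsub f B]. *)
Lemma det_mulmx_sum_ffun :
  \det (A *m B) =
  \sum_(f : {ffun 'I_k -> 'I_n}) (\prod_i A i (f i)) * \det (rowsub f B).
Proof.
transitivity (\sum_(f : {ffun 'I_k -> 'I_n}) \sum_(s : 'S_k)
    (-1) ^+ s * \prod_i (A i (f i) * B (f i) (s i))).
  rewrite exchange_big; apply: eq_bigr => /= s _; rewrite -big_distrr /=.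
  congr (_ * _); rewrite -(bigA_distr_bigA (fun i j => A i j * B j (s i))) /=.
  by apply: eq_bigr => x _; rewrite mxE.
apply: eq_bigr => f _; rewrite big_distrr /=; apply: eq_bigr => s _.
rewrite mulrCA big_split //=; congr (_ * (_ * _)).
by apply: eq_bigr => x _; rewrite mxE.
Qed.

(* Summing over all maps instead of over the k-subsets of 'I_n costs the factor
   k!, but avoids choosing an enumeration of each subset. *)
Lemma Cauchy_Binet :
  (k`!)%:R * \det (A *m B) =
  \sum_(f : {ffun 'I_k -> 'I_n}) \det (colsub f A) * \det (rowsub f B).
Proof.
(* Replacing [f] by [f] composed with [s] permutes the rows of [rowsub f B] and brings out the sign
   of [s]. Adding these expansions over all [s] builds the Leibniz formula for
   [\det (colsub f A)]. *)
have reindexed (s : 'S_k) : \det (A *m B) = \sum_(f : {ffun 'I_k -> 'I_n})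
    (-1) ^+ s * (\prod_i A i (f (s i))) * \det (rowsub f B).
  pose h (f : {ffun 'I_k -> 'I_n}) := [ffun i => f (s i)].
  rewrite det_mulmx_sum_ffun (reindex_inj (h := h)) /=; last first.
    move=> f g /ffunP fg; apply/ffunP => i.
    by move: (fg (s^-1 i)%g); rewrite !ffunE permKV.
  apply: eq_bigr => f _; rewrite -mulrA mulrCA; congr (_ * _).
    by apply: eq_bigr => i _; rewrite ffunE.
  rewrite (_ : rowsub (h f) B = row_perm s (rowsub f B)); last first.
    by apply/matrixP => i j; rewrite !mxE ffunE.
  by rewrite row_permE det_mulmx det_perm.
transitivity (\sum_(s : 'S_k) \det (A *m B)).
  by rewrite sumr_const card_Sn mulr_natl.
rewrite (eq_bigr _ (fun s _ => reindexed s)) exchange_big /=.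
apply: eq_bigr => f _; rewrite -big_distrl /=; congr (_ * _).
by apply: eq_bigr => s _; congr (_ * _); apply: eq_bigr => i _; rewrite mxE.
Qed.

End CauchyBinet.

Section DetInequalities.
Variable C : numClosedFieldType.

(** Families over [I] are turned into row vectors by enumerating [I]. Below, [I] is the type of maps
    from ['I_k] to ['I_n], which index the minors. *)
Lemma sum_CauchySchwarz (I : finType) (a b : I -> C) :
  `|\sum_i (a i)^* * b i| ^+ 2 <= (\sum_i `|a i| ^+ 2) * (\sum_i `|b i| ^+ 2).
Proof.
have dotE (x y : I -> C) : \sum_i (x i)^* * y i =
    dotmx (\row_(i < #|I|) y (enum_val i)) (\row_(i < #|I|) x (enum_val i)).
  rewrite dotmxE mxE (reindex (@enum_val I I)) /=; last first.
    exact/onW_bij/enum_val_bij.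
  by apply: eq_bigr => i _; rewrite !mxE mulrC.
have normE (x : I -> C) : \sum_i `|x i| ^+ 2 = \sum_i (x i)^* * x i.
  by apply: eq_bigr => i _; rewrite normCKC.
by rewrite !normE !dotE mulrC; apply: CauchySchwarz.
Qed.

Lemma det_colsub_trmxC (k n : nat) (P : 'M[C]_(n, k)) (f : 'I_k -> 'I_n) :
  \det (colsub f (P^t*)) = (\det (rowsub f P))^*.
Proof.
rewrite -det_map_mx -det_tr; congr (\det _).
by apply/matrixP => i j; rewrite !mxE.
Qed.

Lemma det_trmxC_mul (k n : nat) (P Q : 'M[C]_(n, k)) :
  (k`!)%:R * \det (P^t* *m Q) =
  \sum_(f : {ffun 'I_k -> 'I_n}) (\det (rowsub f P))^* * \det (rowsub f Q).
Proof.
by rewrite Cauchy_Binet; apply: eq_bigr => f _; rewrite det_colsub_trmxC.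
Qed.

Lemma det_Gram_ge0 (k n : nat) (P : 'M[C]_(n, k)) : 0 <= \det (P^t* *m P).
Proof.
have k_gt0 : 0 < (k`!)%:R :> C by rewrite ltr0n fact_gt0.
rewrite -(pmulr_rge0 _ k_gt0) det_trmxC_mul.
by apply: sumr_ge0 => f _; rewrite -normCKC exprn_ge0.
Qed.

(** By Cauchy-Binet, [k!] times each determinant is an inner product of the vectors of minors
    [\det (rowsub f _)]. Both sides thus acquire the same factor [k!^2], and the ordinary
    Cauchy-Schwarz inequality applies. *)
Lemma det_Gram_CauchySchwarz (k n : nat) (P Q : 'M[C]_(n, k)) :
  `|\det (P^t* *m Q)| ^+ 2 <= \det (P^t* *m P) * \det (Q^t* *m Q).
Proof.
have k2_gt0 : 0 < (k`!)%:R ^+ 2 :> C by rewrite exprn_gt0 // ltr0n fact_gt0.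
rewrite -(ler_pM2l k2_gt0) -[X in X * `|_| ^+ 2 <= _](gtr0_norm k2_gt0).
rewrite normrX -exprMn -normrM det_trmxC_mul.
rewrite [in X in _ <= X]expr2 mulrACA !det_trmxC_mul.
apply: le_trans (sum_CauchySchwarz _ _) _.
by rewrite le_eqVlt; apply/orP; left; apply/eqP; congr (_ * _);
  apply: eq_bigr => f _; rewrite normCKC.
Qed.

(** Once [s] is sorted it is strictly increasing, so its entry at position [i] is at least [i]; the
    factors then compare one by one. *)
Lemma prod_sorted_le (d : nat -> C) (m : nat) (s : seq nat) :
  (forall i, (i < m)%N -> 0 <= d i) ->
  (forall i j, (i <= j < m)%N -> d j <= d i) ->
  uniq s -> all (ltn^~ m) s ->
  \prod_(i <- s) d i <= \prod_(i < size s) d i.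
Proof.
move=> d_ge0 d_le s_uniq s_lt.
rewrite -(perm_big _ (permEl (perm_sort leq s))) /=.
have size_t := size_sort leq s.
have : sorted ltn (sort leq s).
  by rewrite ltn_sorted_uniq_leq sort_uniq s_uniq sort_sorted //; apply: leq_total.
have : all (ltn^~ m) (sort leq s) by rewrite all_sort.
rewrite -size_t; move: (sort leq s) => t {s s_uniq s_lt size_t} t_lt t_sorted.
have nth_ge i : (i < size t)%N -> (i <= nth 0%N t i)%N.
  elim: i => // i IH it; apply: leq_ltn_trans (IH (ltnW it)) _.
  by apply: (sorted_ltn_nth ltn_trans) => //; rewrite inE // ltnW.
rewrite (big_nth 0%N) big_mkord; apply: ler_prod => i _.
have lt_m : (nth 0%N t i < m)%N by apply: (allP t_lt); rewrite mem_nth.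
by rewrite d_ge0 //= d_le // nth_ge.
Qed.

(** Cauchy-Binet makes the determinant a weighted mean of the products of the [d (f i)]. The
    weights, squared moduli of minors of [V] over [k!], sum to [\det (V^t* *m V) = 1]. A
    non-injective [f] repeats a row and has weight zero; an injective one picks distinct indices, so
    [prod_sorted_le] bounds its product. *)
Lemma det_compression_le (k n : nat) (d : nat -> C) (V : 'M[C]_(n, k)) :
  (forall i, (i < n)%N -> 0 <= d i) ->
  (forall i j, (i <= j < n)%N -> d j <= d i) ->
  V^t* *m V = 1%:M ->
  \det (V^t* *m diag_mx (\row_(i < n) d i) *m V) <= \prod_(i < k) d i.
Proof.
move=> d_ge0 d_le V_frame.
have k_gt0 : 0 < (k`!)%:R :> C by rewrite ltr0n fact_gt0.
rewrite -(ler_pM2l k_gt0) -mulmxA det_trmxC_mul.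
have -> : (k`!)%:R * \prod_(i < k) d i = \sum_(f : {ffun 'I_k -> 'I_n})
    (\det (rowsub f V))^* * \det (rowsub f V) * \prod_(i < k) d i.
  by rewrite -mulr_suml -det_trmxC_mul V_frame det1 mulr1.
apply: ler_sum => f _.
have -> : rowsub f (diag_mx (\row_(i < n) d i) *m V) =
    diag_mx (\row_i d (f i)) *m rowsub f V.
  by rewrite !mul_diag_mx; apply/matrixP => i j; rewrite !mxE.
rewrite det_mulmx det_diag [X in _ * X]mulrC mulrA.
have [f_inj|/injectivePn [i1 [i2 i12 f12]]] := boolP (injectiveb f); last first.
  by rewrite (determinant_alternate i12) ?mulr0 ?mul0r // => j; rewrite !mxE f12.
apply: ler_wpM2l; first by rewrite -normCKC exprn_ge0.
under eq_bigr do rewrite mxE.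
have := @prod_sorted_le d n [seq val (f i) | i <- enum 'I_k] d_ge0 d_le.
rewrite size_map size_enum_ord big_map big_enum /=; apply.
  by rewrite map_inj_uniq ?enum_uniq // => i j /val_inj /(injectiveP _ f_inj).
by apply/allP => _ /mapP [i _ ->] /=.
Qed.
End DetInequalities.

(** * Spectral decomposition *)

Lemma char_poly_similar (F : fieldType) (n : nat) (P A : 'M[F]_n) :
  P \in unitmx -> char_poly (invmx P *m A *m P) = char_poly A.
Proof.
move=> P_unit; have pP_unit : map_mx polyC P \in unitmx by rewrite map_unitmx.
rewrite /char_poly.
have -> : char_poly_mx (invmx P *m A *m P) =
    invmx (map_mx polyC P) *m char_poly_mx A *m map_mx polyC P.
  rewrite /char_poly_mx mulmxBr mulmxBl !map_mxM map_invmx; congr (_ - _).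
  by rewrite scalar_mxC mulmxKV.
by rewrite !det_mulmx mulrAC -det_mulmx mulVmx // det1 mul1r.
Qed.

Lemma char_poly_diag (F : comNzRingType) (n : nat) (d : 'rV[F]_n) :
  char_poly (diag_mx d) = \prod_(i < n) ('X - (d 0 i)%:P).
Proof.
rewrite char_poly_trig ?diag_mx_is_trig //.
by apply: eq_bigr => i _; rewrite mxE eqxx.
Qed.

Lemma hermitian_spectral (C : numClosedFieldType) (n : nat) (A : 'M[C]_n) :
  A^t* = A -> exists2 W : 'M[C]_n, W \is unitarymx &
  exists2 d : 'rV[C]_n, d \is a realmx & A = W^t* *m diag_mx d *m W.
Proof.
move=> A_herm; have A_hermmx : A \is hermsymmx.
  by apply/is_hermitianmxP; rewrite expr0 scale1r A_herm.
exists (spectralmx A); first exact: spectral_unitarymx.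
exists (spectral_diag A); first exact: hermitian_spectral_diag_real.
rewrite -invmx_unitary ?spectral_unitarymx //.
exact/orthomx_spectralP/hermitian_normalmx.
Qed.

Section Spectrum.
Variable R : realType.
Local Notation C := (complex R).

Lemma adjmxE (n : nat) (A : 'M[C]_n) : adjmx A = A^t*.
Proof. by rewrite /adjmx map_trmx. Qed.

Lemma qformE (n : nat) (A : 'M[C]_n) (v : 'cV[C]_n) :
  qform A v = (v^t* *m A *m v) 0 0.
Proof. by rewrite /qform map_trmx. Qed.

Lemma hermitian_spectral_diag (n : nat) (A : 'M[C]_n) : Defs.hermitian A ->
  exists d : 'I_n -> R, exists2 W : 'M[C]_n, W \is unitarymx &
    A = W^t* *m diag_mx (\row_i ((d i)%:C)%C) *m W.
Proof.
rewrite /Defs.hermitian adjmxE => /hermitian_spectral [W W_unitary [d d_real A_def]].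
exists (fun i => complex.Re (d 0 i)), W; first exact: W_unitary.
suff -> : \row_i ((complex.Re (d 0 i))%:C)%C = d by exact: A_def.
by apply/rowP => i; rewrite mxE RRe_real //; apply: (mxOverP d_real).
Qed.

(** Since [eigs] is a choice, it suffices to exhibit one spectrum: the sorted diagonal of a spectral
    decomposition. *)
Lemma is_spectrum_eigs (n : nat) (A : 'M[C]_n) :
  Defs.hermitian A -> is_spectrum A (eigs A).
Proof.
move=> /hermitian_spectral_diag [d [W W_unitary A_def]].
apply: ClassicalEpsilon.epsilon_spec.
pose s := [seq d i | i <- enum 'I_n].
exists (sort (fun x y => y <= x) s); split; [|split].
- by rewrite size_sort size_map size_enum_ord.
- by apply: sort_sorted => x y; rewrite orbC le_total.
rewrite (perm_big _ (permEl (perm_sort _ _))) /= big_map big_enum /=.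
rewrite A_def -(invmx_unitary W_unitary) char_poly_similar ?unitarymx_unit //.
by rewrite char_poly_diag; apply: eq_bigr => i _; rewrite mxE.
Qed.

(** The spectral theorem yields the eigenvalues in an unknown order. Unique factorization of the
    characteristic polynomial makes that order a permutation of [eigs A], which is absorbed into the
    rows of [W]. *)
Lemma hermitian_diagonalization (n : nat) (A : 'M[C]_n) : Defs.hermitian A ->
  exists2 W : 'M[C]_n, W \is unitarymx &
    A = W^t* *m diag_mx (\row_(i < n) ((nth 0 (eigs A) i)%:C)%C) *m W.
Proof.
move=> A_herm; have [size_s [_ char_s]] := is_spectrum_eigs A_herm.
have [d [W W_unitary A_def]] := hermitian_spectral_diag A_herm.
have : perm_eq [seq (x%:C)%C | x <- eigs A] [tuple ((d i)%:C)%C | i < n].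
  apply: prod_XsubC_eq; rewrite big_map -char_s A_def -(invmx_unitary W_unitary).
  rewrite char_poly_similar ?unitarymx_unit // char_poly_diag.
  by rewrite /= big_map big_enum /=; apply: eq_bigr => i _; rewrite mxE.
case/tuple_permP => p eigs_p; exists (row_perm p W).
  apply/unitarymxP; rewrite row_permE trmx_mul map_mxM mulmxA.
  rewrite -(mulmxA (perm_mx p)) (unitarymxP W_unitary) mulmx1.
  by rewrite tr_perm_mx map_perm_mx -perm_mxM mulgV perm_mx1.
rewrite {1}A_def; apply/matrixP => i j; rewrite !mul_mx_diag !mxE.
rewrite (reindex_inj (@perm_inj _ p)) /=; apply: eq_bigr => l _.
rewrite !mxE; congr (_ * _ * _).
have := congr1 (fun s => nth 0 s l) eigs_p.
rewrite (nth_map 0) ?size_s // => ->.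
by rewrite -tnth_nth !tnth_mktuple.
Qed.

End Spectrum.

(** * Eigenvalues of the geometric mean *)

Lemma unitary_conj_mul (C : numClosedFieldType) (n : nat) (W D E : 'M[C]_n) :
  W \is unitarymx ->
  (W^t* *m D *m W) *m (W^t* *m E *m W) = W^t* *m (D *m E) *m W.
Proof. by move=> W_unitary; rewrite !mulmxA mulmxtVK. Qed.

Section PositiveMatrices.
Variable R : realType.
Local Notation C := (complex R).

Lemma trmxC_mul (m n p : nat) (P : 'M[C]_(m, n)) (Q : 'M[C]_(n, p)) :
  (P *m Q)^t* = Q^t* *m P^t*.
Proof. by rewrite trmx_mul map_mxM. Qed.

Lemma trmxC_diag_real (n : nat) (d : 'I_n -> R) :
  (diag_mx (\row_i ((d i)%:C)%C))^t* = diag_mx (\row_i ((d i)%:C)%C) :> 'M[C]_n.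
Proof.
rewrite tr_diag_mx map_diag_mx; congr diag_mx.
by apply/rowP => i; rewrite !mxE; apply: conjc_real.
Qed.

Lemma unitmx_eigs (n : nat) (A : 'M[C]_n) : Defs.hermitian A ->
  (A \in unitmx) = [forall i : 'I_n, nth 0 (eigs A) i != 0].
Proof.
move=> A_herm; have [W W_unitary {1}->] := hermitian_diagonalization A_herm.
have W_unit := unitarymx_unit W_unitary.
have Wt_unit : W^t* \in unitmx by rewrite unitarymx_unit ?trmxC_unitary.
rewrite !unitmx_mul W_unit Wt_unit andbT /=.
rewrite unitmxE det_diag unitfE.
apply/prodf_neq0/forallP => s_neq0 i.
  by have := s_neq0 i isT; rewrite mxE fmorph_eq0.
by rewrite mxE fmorph_eq0.
Qed.

Lemma qform_eigenvector (n : nat) (A : 'M[C]_n) (i : 'I_n) : Defs.hermitian A ->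
  exists2 v : 'cV[C]_n, v != 0 & qform A v = ((nth 0 (eigs A) i)%:C)%C.
Proof.
move=> /hermitian_diagonalization [W W_unitary A_def].
(* Column [i] of [W^t*], a unit eigenvector for the eigenvalue at position [i]. *)
exists (W^t* *m delta_mx i 0).
  apply/eqP => /(congr1 (fun v => W *m v)).
  rewrite mulmx0 mulmxA (unitarymxP W_unitary) mul1mx => /matrixP /(_ i 0) /eqP.
  by rewrite !mxE !eqxx oner_eq0.
rewrite qformE {1}A_def.
rewrite trmxC_mul trmxCK !mulmxA (mulmxtVK _ W_unitary) -!mulmxA.
rewrite (mulmxA W) (unitarymxP W_unitary) mul1mx trmx_delta map_delta_mx.
by rewrite mulmxA -rowE -colE !mxE eqxx.
Qed.

Lemma hpsd_eigs_ge0 (n : nat) (A : 'M[C]_n) (i : nat) :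
  hpsd A -> 0 <= nth 0 (eigs A) i.
Proof.
move=> [A_herm A_ge0]; have [size_s _] := is_spectrum_eigs A_herm.
(* Past the end of [eigs A], [nth] returns its default 0, which is nonnegative. *)
have [lt_in|ge_in] := ltnP i n; last by rewrite nth_default ?size_s.
have [v _ qv] := qform_eigenvector (Ordinal lt_in) A_herm.
by move: (A_ge0 v); rewrite qv ler0c.
Qed.

Lemma hpd_eigs_gt0 (n : nat) (A : 'M[C]_n) (i : nat) :
  hpd A -> (i < n)%N -> 0 < nth 0 (eigs A) i.
Proof.
move=> [A_herm A_gt0] lt_in.
have [v v_neq0 qv] := qform_eigenvector (Ordinal lt_in) A_herm.
by move: (A_gt0 v v_neq0); rewrite qv ltcR.
Qed.

Lemma hpd_hpsd (n : nat) (A : 'M[C]_n) : hpd A -> hpsd A.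
Proof.
move=> [A_herm A_gt0]; split=> // v; have [->|/A_gt0/ltW//] := eqVneq v 0.
by rewrite qformE mulmx0 mxE.
Qed.

Lemma hpd_unitmx (n : nat) (A : 'M[C]_n) : hpd A -> A \in unitmx.
Proof.
move=> A_pd; rewrite unitmx_eigs; last by case: A_pd.
by apply/forallP => i; rewrite gt_eqF // hpd_eigs_gt0.
Qed.

Lemma hpsd_congruence (n : nat) (A P : 'M[C]_n) :
  hpsd A -> hpsd (P^t* *m A *m P).
Proof.
move=> [A_herm A_ge0]; split.
  by move: A_herm; rewrite /Defs.hermitian !adjmxE !trmxC_mul trmxCK mulmxA => ->.
move=> v; rewrite qformE.
by move: (A_ge0 (P *m v)); rewrite qformE trmxC_mul !mulmxA.
Qed.

Lemma hpsd_diag (n : nat) (d : 'I_n -> R) :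
  (forall i, 0 <= d i) -> hpsd (diag_mx (\row_i ((d i)%:C)%C)).
Proof.
move=> d_ge0; split; first by rewrite /Defs.hermitian adjmxE trmxC_diag_real.
move=> v; rewrite qformE mul_mx_diag mxE; apply: sumr_ge0 => i _.
by rewrite !mxE mulrAC -normCKC mulr_ge0 ?exprn_ge0 // ler0c.
Qed.

(** As [sqrtmx] is a choice, one witness is enough: take square roots of the eigenvalues in an
    orthonormal eigenbasis. *)
Lemma hpsd_sqrtmx (n : nat) (A : 'M[C]_n) :
  hpsd A -> hpsd (sqrtmx A) /\ sqrtmx A *m sqrtmx A = A.
Proof.
move=> A_psd.
apply: (ClassicalEpsilon.epsilon_spec _ (fun X => hpsd X /\ X *m X = A)).
have [W W_unitary A_def] := hermitian_diagonalization (proj1 A_psd).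
pose d (i : 'I_n) := Num.sqrt (nth 0 (eigs A) i).
pose D : 'M[C]_n := diag_mx (\row_i ((d i)%:C)%C).
have DD : D *m D = diag_mx (\row_(i < n) ((nth 0 (eigs A) i)%:C)%C).
  rewrite mulmx_diag; congr diag_mx; apply/rowP => i; rewrite !mxE -rmorphM /=.
  by rewrite -expr2 sqr_sqrtr // hpsd_eigs_ge0.
exists (W^t* *m D *m W); split.
  by apply: hpsd_congruence; apply: hpsd_diag => i; apply: sqrtr_ge0.
by rewrite unitary_conj_mul // DD -A_def.
Qed.

Lemma eigs_nonincreasing (n : nat) (A : 'M[C]_n) (i j : nat) :
  Defs.hermitian A -> (i <= j < n)%N -> nth 0 (eigs A) j <= nth 0 (eigs A) i.
Proof.
move=> /is_spectrum_eigs [size_s [s_sorted _]] /andP [le_ij lt_jn].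
apply: (sorted_leq_nth _ _ 0 s_sorted); rewrite ?inE ?size_s //.
- by move=> x y z xy yz; apply: le_trans yz xy.
- exact: leq_ltn_trans lt_jn.
Qed.

Lemma det_compression_le_eigs (n k : nat) (A : 'M[C]_n) (V : 'M[C]_(n, k)) :
  hpsd A -> V^t* *m V = 1%:M ->
  \det (V^t* *m A *m V) <= ((\prod_(i < k) nth 0 (eigs A) i)%:C)%C.
Proof.
move=> A_psd V_frame; have A_herm := proj1 A_psd.
have [W W_unitary A_def] := hermitian_diagonalization A_herm.
have -> : V^t* *m A *m V =
    (W *m V)^t* *m diag_mx (\row_(i < n) ((nth 0 (eigs A) i)%:C)%C) *m (W *m V).
  by rewrite {1}A_def trmxC_mul !mulmxA.
rewrite rmorph_prod; apply: (det_compression_le (d := fun i => (_ i)%:C%C)).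
- by move=> i _; rewrite ler0c hpsd_eigs_ge0.
- by move=> i j ij; rewrite lecR eigs_nonincreasing.
by rewrite trmxC_mul mulmxA mulmxKtV.
Qed.

Lemma det_compression_eigs (n k : nat) (A : 'M[C]_n) :
  Defs.hermitian A -> (k <= n)%N -> exists2 V : 'M[C]_(n, k),
    V^t* *m V = 1%:M &
    \det (V^t* *m A *m V) = ((\prod_(i < k) nth 0 (eigs A) i)%:C)%C.
Proof.
move=> A_herm le_kn; have [W W_unitary A_def] := hermitian_diagonalization A_herm.
(* [E] selects the first [k] coordinates, so the columns of [W^t* *m E] are eigenvectors for the [k]
   largest eigenvalues. *)
pose E : 'M[C]_(n, k) := colsub (widen_ord le_kn) 1%:M.
have E_diag (d : 'rV[C]_n) :
    E^t* *m diag_mx d *m E = diag_mx (colsub (widen_ord le_kn) d).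
  apply/matrixP => i j; rewrite mul_mx_diag mxE (bigD1 (widen_ord le_kn j)) //=.
  rewrite big1 ?addr0 => [|l lj]; last by rewrite !mxE (negbTE lj) mulr0.
  have wE : (widen_ord le_kn j == widen_ord le_kn i) = (i == j) by rewrite eq_sym.
  rewrite !mxE eqxx mulr1 wE.
  by case: eqP => [->|_]; rewrite ?rmorph1 ?rmorph0 ?mul1r ?mul0r.
exists (W^t* *m E).
  rewrite trmxC_mul trmxCK mulmxA mulmxtVK //.
  (* With all diagonal entries equal to 1, [E_diag] says that [E] has orthonormal columns. *)
  have := E_diag (const_mx 1); rewrite diag_const_mx mulmx1 => ->.
  by rewrite -diag_const_mx; congr diag_mx; apply/rowP => i; rewrite !mxE.
rewrite {1}A_def trmxC_mul trmxCK !mulmxA mulmxtVK // -!mulmxA.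
rewrite (mulmxA W) (unitarymxP W_unitary) mul1mx mulmxA E_diag det_diag rmorph_prod.
by apply: eq_bigr => i _; rewrite !mxE.
Qed.

(** Later proofs about the mean use only this factored form, in which [A], [B] and [gmean A B] are
    all products of the same [X] and [S]. *)
Lemma gmean_spec (n : nat) (A B : 'M[C]_n) : hpd A -> hpd B ->
  exists X S : 'M[C]_n, [/\ X^t* = X, X *m X = A, hpsd S, X *m S *m S *m X = B &
    gmean A B = X *m S *m X].
Proof.
move=> A_pd B_pd; rewrite /gmean.
have [] := hpsd_sqrtmx (hpd_hpsd A_pd); set X := sqrtmx A => -[X_herm _] XX.
have X_unit : X \in unitmx.
  by have := hpd_unitmx A_pd; rewrite -XX unitmx_mul => /andP [].
rewrite /Defs.hermitian adjmxE in X_herm.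
have Xi_herm : (invmx X)^t* = invmx X by rewrite trmx_inv map_invmx X_herm.
have := hpsd_congruence (invmx X) (hpd_hpsd B_pd); rewrite Xi_herm.
move=> /hpsd_sqrtmx []; set S := sqrtmx _ => S_psd SS.
exists X, S; split=> //.
by rewrite -(mulmxA X) SS !mulmxA mulmxV // mul1mx mulmxKV.
Qed.

Lemma hpsd_gmean (n : nat) (A B : 'M[C]_n) :
  hpd A -> hpd B -> hpsd (gmean A B).
Proof.
move=> A_pd B_pd; have [X [S [X_herm _ S_psd _ ->]]] := gmean_spec A_pd B_pd.
by rewrite -{1}X_herm; apply: hpsd_congruence.
Qed.

(** The mean is positive semidefinite, and it is invertible because its factors [X] and [S] also
    divide the invertible matrix [B]. Strict positivity allows logarithms of these eigenvalues. *)
Lemma gmean_eigs_gt0 (n : nat) (A B : 'M[C]_n) (i : nat) :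
  hpd A -> hpd B -> (i < n)%N -> 0 < nth 0 (eigs (gmean A B)) i.
Proof.
move=> A_pd B_pd lt_in; have G_psd := hpsd_gmean A_pd B_pd.
rewrite lt_def hpsd_eigs_ge0 // andbT.
suff : gmean A B \in unitmx.
  rewrite unitmx_eigs; last by case: G_psd.
  by move=> /forallP /(_ (Ordinal lt_in)).
have [X [S [_ _ _ XSSX ->]]] := gmean_spec A_pd B_pd.
have := hpd_unitmx B_pd; rewrite -XSSX !unitmx_mul.
by case/andP => /andP [/andP [-> ->] _] _.
Qed.

Lemma gmean_log_majorization (n k : nat) (A B : 'M[C]_n) :
  hpd A -> hpd B -> (k <= n)%N ->
  (\prod_(i < k) nth 0 (eigs (gmean A B)) i) ^+ 2 <=
  (\prod_(i < k) nth 0 (eigs A) i) * (\prod_(i < k) nth 0 (eigs B) i).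
Proof.
move=> A_pd B_pd le_kn; have G_psd := hpsd_gmean A_pd B_pd.
have [V V_frame det_G] := det_compression_eigs (proj1 G_psd) le_kn.
have [X [S [X_herm XX [S_herm _] XSSX G_def]]] := gmean_spec A_pd B_pd.
rewrite /Defs.hermitian adjmxE in S_herm.
have GramG : (X *m V)^t* *m (S *m X *m V) = V^t* *m gmean A B *m V.
  by rewrite trmxC_mul X_herm G_def !mulmxA.
have GramA : (X *m V)^t* *m (X *m V) = V^t* *m A *m V.
  by rewrite trmxC_mul X_herm -XX !mulmxA.
have GramB : (S *m X *m V)^t* *m (S *m X *m V) = V^t* *m B *m V.
  by rewrite !trmxC_mul X_herm S_herm -XSSX !mulmxA.
have det_le := det_Gram_CauchySchwarz (X *m V) (S *m X *m V).
have detA_ge0 := det_Gram_ge0 (X *m V).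
have detB_ge0 := det_Gram_ge0 (S *m X *m V).
rewrite GramG GramA GramB det_G ger0_norm in det_le; last first.
  by rewrite ler0c prodr_ge0 // => i _; apply: hpsd_eigs_ge0.
rewrite GramA in detA_ge0; rewrite GramB in detB_ge0.
rewrite -lecR rmorphXn rmorphM /=; apply: le_trans det_le _.
have A_le := det_compression_le_eigs (hpd_hpsd A_pd) V_frame.
have B_le := det_compression_le_eigs (hpd_hpsd B_pd) V_frame.
exact: ler_pM detA_ge0 detB_ge0 A_le B_le.
Qed.
End PositiveMatrices.

(** * Log-convexity of power series *)

(** The induction keeps the last coefficient times the full partial sum of [d] below the weighted
    sum: moving to the next, smaller coefficient only lowers its product with a nonnegative partial
    sum. *)
Lemma Abel_sum_ge0 (R : realDomainType) (k : nat) (c d : nat -> R) :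
  (forall i, (i < k)%N -> 0 <= c i) ->
  (forall i j, (i <= j < k)%N -> c j <= c i) ->
  (forall j, (j <= k)%N -> 0 <= \sum_(i < j) d i) ->
  0 <= \sum_(i < k) c i * d i.
Proof.
move=> c_ge0 c_le d_ge0; case: k => [|k] in c_ge0 c_le d_ge0 *.
  by rewrite big_ord0.
suff /(_ k (leqnn _)) : forall m, (m < k.+1)%N ->
    c m * \sum_(i < m.+1) d i <= \sum_(i < m.+1) c i * d i.
  by apply: le_trans; rewrite mulr_ge0 ?c_ge0 ?d_ge0.
elim=> [|m IH] lt_mk; first by rewrite !big_ord1.
rewrite big_ord_recr [leRHS]big_ord_recr /= mulrDr lerD2r.
apply: le_trans (IH (ltnW lt_mk)).
by rewrite ler_wpM2r ?d_ge0 ?c_le ?leqnSn // ltnW.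
Qed.

Section ExponentialSum.
Variables (R : realType) (a : nat -> R) (N : nat).
Hypothesis a_ge0 : forall j, 0 <= a j.

Definition expsum (t : R) : R := \sum_(j < N) a j * expR t ^+ j.

(** The derivative of the logarithm of [expsum] at [t], when [expsum t] is positive, written out as
    a quotient of finite sums. *)
Definition log_slope (t : R) : R :=
  (\sum_(j < N) j%:R * (a j * expR t ^+ j)) / expsum t.

Lemma expsum_ge0 (t : R) : 0 <= expsum t.
Proof.
by apply: sumr_ge0 => j _; rewrite mulr_ge0 // exprn_ge0 // expR_ge0.
Qed.

(** The logarithmic argument needs a positive sum; this isolates the degenerate case where the first
    [N] coefficients all vanish. *)
Lemma expsum_gt0_or_eq0 : (forall t, 0 < expsum t) \/ (forall t, expsum t = 0).
Proof.
have [/forallP a_eq0|] := boolP [forall j : 'I_N, a j == 0].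
  by right=> t; apply: big1 => j _; rewrite (eqP (a_eq0 j)) mul0r.
rewrite negb_forall => /existsP [j aj_neq0]; left=> t.
rewrite /expsum (bigD1 j) //= ltr_pwDl //.
  by rewrite mulr_gt0 ?exprn_gt0 ?expR_gt0 // lt_def aj_neq0 a_ge0.
by apply: sumr_ge0 => i _; rewrite mulr_ge0 // exprn_ge0 // expR_ge0.
Qed.

Lemma log_slope_ge0 (t : R) : 0 <= log_slope t.
Proof.
rewrite divr_ge0 ?expsum_ge0 // sumr_ge0 // => j _.
by rewrite !mulr_ge0 // exprn_ge0 // expR_ge0.
Qed.

(** The exponentiated tangent inequality for the logarithm of [expsum]. After [exp (c (t - s))] is
    factored out of each term, [exp y >= 1 + y] applies with [y = (j - c) (t - s)]; the linear parts
    sum to zero exactly because [c] is the slope at [s]. *)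
Lemma expsum_tangent (s t : R) : 0 < expsum s ->
  expsum s * expR (log_slope s * (t - s)) <= expsum t.
Proof.
move=> s_gt0; set c := log_slope s.
have expand j : expR t ^+ j =
    expR (c * (t - s)) * (expR s ^+ j * expR ((j%:R - c) * (t - s))).
  rewrite -!expRM_natl -!expRD; congr expR; ring.
have -> : expsum s * expR (c * (t - s)) = \sum_(j < N)
    a j * (expR (c * (t - s)) * (expR s ^+ j * (1 + (j%:R - c) * (t - s)))).
  transitivity (expR (c * (t - s)) *
    (expsum s + (t - s) *
      (\sum_(j < N) j%:R * (a j * expR s ^+ j) - c * expsum s))).
    by rewrite /c /log_slope divfK ?gt_eqF // subrr mulr0 addr0 mulrC.
  rewrite /expsum [c * \sum_(_ < _) _]mulr_sumr -sumrB
    [(t - s) * \sum_(_ < _) _]mulr_sumr -big_split /=.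
  rewrite mulr_sumr; by apply: eq_bigr => j _; ring.
apply: ler_sum => j _; rewrite expand ler_wpM2l // ler_wpM2l ?expR_ge0 //.
by rewrite ler_wpM2l ?exprn_ge0 ?expR_ge0 // expR_ge1Dx.
Qed.

(* Multiplying the two tangent inequalities between s and t gives
   1 <= exp ((log_slope t - log_slope s) (t - s)). *)
Lemma log_slope_nondecreasing (s t : R) : (forall t, 0 < expsum t) ->
  s <= t -> log_slope s <= log_slope t.
Proof.
move=> f_gt0; rewrite le_eqVlt => /orP [/eqP -> //|lt_st].
have := expsum_tangent t (f_gt0 s).
have := expsum_tangent s (f_gt0 t).
rewrite -ler_pdivlMr ?expR_gt0 // -expRN => le_ts le_st.
have := le_trans le_st le_ts; rewrite ler_pM2l // ler_expR -mulrN opprB.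
by rewrite ler_pM2r ?subr_gt0.
Qed.

Lemma expsum_prod_le (k : nat) (u v w : nat -> R) :
  (forall i j, (i <= j < k)%N -> w j <= w i) ->
  (forall j, (j <= k)%N ->
     (\sum_(i < j) w i) *+ 2 <= \sum_(i < j) u i + \sum_(i < j) v i) ->
  (\prod_(i < k) expsum (w i)) ^+ 2 <=
  (\prod_(i < k) expsum (u i)) * (\prod_(i < k) expsum (v i)).
Proof.
move=> w_le w_maj; have [f_gt0|f0] := expsum_gt0_or_eq0; last first.
  by rewrite expr2 le_eqVlt; apply/orP; left; apply/eqP; congr (_ * _);
    apply: eq_bigr => i _; rewrite !f0.
pose d i := u i + v i - w i *+ 2.
have cd_ge0 : 0 <= \sum_(i < k) log_slope (w i) * d i.
  apply: (Abel_sum_ge0 (c := fun i => log_slope (w i))) => [i _|i j ij|j le_jk].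
  - exact: log_slope_ge0.
  - by apply: log_slope_nondecreasing => //; apply: w_le.
  - by rewrite /d sumrB big_split /= sumrMnl subr_ge0 w_maj.
(* The inserted exponentials multiply to the exponential of the Abel sum, hence to at least 1. Each
   factor is then bounded by the product of two tangent inequalities at [w i], towards [u i] and
   [v i]. *)
apply: (@le_trans _ _ (\prod_(i < k)
    (expsum (w i) ^+ 2 * expR (log_slope (w i) * d i)))).
  rewrite big_split /= -expR_sum prodrXl ler_peMr ?exprn_ge0 //.
    by rewrite prodr_ge0 // => i _; apply: expsum_ge0.
  by apply: le_trans (expR_ge1Dx _); rewrite lerDl.
rewrite -big_split /=; apply: ler_prod => i _; apply/andP; split.
  by rewrite mulr_ge0 ?exprn_ge0 ?expsum_ge0 ?expR_ge0.
have -> : log_slope (w i) * d i =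
    log_slope (w i) * (u i - w i) + log_slope (w i) * (v i - w i).
  by rewrite -mulrDr addrACA -opprD.
rewrite expRD expr2 mulrACA.
by apply: ler_pM; rewrite ?mulr_ge0 ?expsum_ge0 ?expR_ge0 // expsum_tangent.
Qed.

Lemma polynomial_prod_le (k : nat) (x y z : nat -> R) :
  (forall i, (i < k)%N -> [/\ 0 < x i, 0 < y i & 0 < z i]) ->
  (forall i j, (i <= j < k)%N -> x j <= x i) ->
  (forall j, (j <= k)%N ->
     (\prod_(i < j) x i) ^+ 2 <= (\prod_(i < j) y i) * (\prod_(i < j) z i)) ->
  (\prod_(i < k) \sum_(j < N) a j * x i ^+ j) ^+ 2 <=
  (\prod_(i < k) \sum_(j < N) a j * y i ^+ j) *
  (\prod_(i < k) \sum_(j < N) a j * z i ^+ j).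
Proof.
move=> pos x_le x_maj.
have log_sum (f : nat -> R) j : (forall i, (i < k)%N -> 0 < f i) -> (j <= k)%N ->
    \prod_(i < j) f i = expR (\sum_(i < j) ln (f i)).
  move=> f_gt0 le_jk; rewrite expR_sum; apply: eq_bigr => i _.
  by rewrite lnK // posrE f_gt0 // (leq_trans (ltn_ord i)).
have expsum_ln (f : nat -> R) : (forall i, (i < k)%N -> 0 < f i) ->
    \prod_(i < k) \sum_(j < N) a j * f i ^+ j = \prod_(i < k) expsum (ln (f i)).
  by move=> f_gt0; apply: eq_bigr => i _; rewrite /expsum lnK // posrE f_gt0.
have x_gt0 i : (i < k)%N -> 0 < x i by case/pos.
have y_gt0 i : (i < k)%N -> 0 < y i by case/pos.
have z_gt0 i : (i < k)%N -> 0 < z i by case/pos.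
rewrite (expsum_ln x) // (expsum_ln y) // (expsum_ln z) //.
have := @expsum_prod_le k (fun i => ln (y i)) (fun i => ln (z i))
  (fun i => ln (x i)); apply => [i j ij|j le_jk].
  have /andP [le_ij lt_jk] := ij.
  by rewrite /= ler_ln ?posrE ?x_gt0 ?x_le // (leq_ltn_trans le_ij).
by have := x_maj _ le_jk; rewrite !log_sum // -expRM_natl -expRD ler_expR mulr_natl.
Qed.

End ExponentialSum.

(** * Passage from polynomials to power series *)

Section PowerSeries.
Variables (R : realType) (a : nat -> R).
Hypothesis a_ge0 : forall j, 0 <= a j.

(** The radius is a supremum, so some point of convergence [r] lies beyond [x], and the series at
    [x] is dominated by the one at [r]. *)
Lemma cvg_below_radius (x : R) : 0 <= x -> (x%:E < conv_radius a)%E ->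
  cvgn (series (fun j => a j * x ^+ j)).
Proof.
move=> x_ge0 /ereal_sup_gt [_ [r [r_ge0 r_cvg] <-]]; rewrite lte_fin => lt_xr.
apply: series_le_cvg r_cvg => j; rewrite ?mulr_ge0 ?exprn_ge0 //.
by rewrite ler_wpM2l // lerXn2r // ?nnegrE // ltW.
Qed.

Lemma cvg_prod_series (k : nat) (x : nat -> R) :
  (forall i, (i < k)%N -> cvgn (series (fun j => a j * x i ^+ j))) ->
  ((\prod_(i < k) \sum_(j < N) a j * x i ^+ j) @[N --> \oo] -->
    \prod_(i < k) Defs.pseries a (x i))%classic.
Proof.
elim: k => [|k IH] x_cvg.
  by rewrite big_ord0; under eq_fun do rewrite big_ord0; apply: cvg_cst.
rewrite big_ord_recr /=; under eq_fun do rewrite big_ord_recr /=.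
apply: cvgM; first by apply: IH => i lt_ik; apply/x_cvg/ltnW.
suff -> : (fun N => \sum_(j < N) a j * x k ^+ j) =
    series (fun j => a j * x k ^+ j) by exact: x_cvg.
by apply/funext => N; rewrite /series /= big_mkord.
Qed.

Lemma pseries_prod_le (k : nat) (x y z : nat -> R) :
  (forall i, (i < k)%N -> [/\ 0 < x i, 0 < y i & 0 < z i]) ->
  (forall i, (i < k)%N ->
    [/\ (x i)%:E < conv_radius a, (y i)%:E < conv_radius a &
        (z i)%:E < conv_radius a]%E) ->
  (forall i j, (i <= j < k)%N -> x j <= x i) ->
  (forall j, (j <= k)%N ->
     (\prod_(i < j) x i) ^+ 2 <= (\prod_(i < j) y i) * (\prod_(i < j) z i)) ->
  (\prod_(i < k) Defs.pseries a (x i)) ^+ 2 <=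
  (\prod_(i < k) Defs.pseries a (y i)) * (\prod_(i < k) Defs.pseries a (z i)).
Proof.
move=> pos radius x_le x_maj.
have cvg_of (f : nat -> R) : (forall i, (i < k)%N -> 0 < f i) ->
    (forall i, (i < k)%N -> ((f i)%:E < conv_radius a)%E) ->
    ((\prod_(i < k) \sum_(j < N) a j * f i ^+ j) @[N --> \oo] -->
      \prod_(i < k) Defs.pseries a (f i))%classic.
  move=> f_gt0 f_radius; apply: cvg_prod_series => i lt_ik.
  by apply: cvg_below_radius; [rewrite ltW ?f_gt0|apply: f_radius].
have x_cvg := cvg_of x (fun i lt => let: And3 h _ _ := pos i lt in h)
  (fun i lt => let: And3 h _ _ := radius i lt in h).
have y_cvg := cvg_of y (fun i lt => let: And3 _ h _ := pos i lt in h)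
  (fun i lt => let: And3 _ h _ := radius i lt in h).
have z_cvg := cvg_of z (fun i lt => let: And3 _ _ h := pos i lt in h)
  (fun i lt => let: And3 _ _ h := radius i lt in h).
rewrite expr2; apply: ler_cvg_to (cvgM x_cvg x_cvg) (cvgM y_cvg z_cvg) _.
apply: nearW => N; have := polynomial_prod_le N a_ge0 pos x_le x_maj.
by rewrite expr2.
Qed.

End PowerSeries.

(** * Spectral bound for the mean and conclusion *)

(** Log-majorization for a single eigenvalue bounds the square of the largest eigenvalue of the mean
    by the product of those of [A] and [B]. This keeps the spectrum of the mean inside the disc of
    convergence. *)
Lemma gmean_eigs_le_max (R : realType) (n : nat) (A B : 'M[complex R]_n) (i : nat) :
  hpd A -> hpd B -> (i < n)%N ->
  nth 0 (eigs (gmean A B)) i <= Num.max (nth 0 (eigs A) 0) (nth 0 (eigs B) 0).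
Proof.
move=> A_pd B_pd lt_in; have n_gt0 : (0 < n)%N by apply: leq_ltn_trans lt_in.
have G_psd := hpsd_gmean A_pd B_pd.
apply: (@le_trans _ _ (nth 0 (eigs (gmean A B)) 0)).
  by apply: eigs_nonincreasing; [case: G_psd|rewrite lt_in].
have A_ge0 := hpsd_eigs_ge0 0 (hpd_hpsd A_pd).
have B_ge0 := hpsd_eigs_ge0 0 (hpd_hpsd B_pd).
move: (gmean_log_majorization A_pd B_pd n_gt0) A_ge0 B_ge0.
move: (eigs (gmean A B)) (eigs A) (eigs B) => g s t.
rewrite !big_ord1 => g_le s_ge0 t_ge0.
rewrite leNgt gt_max; apply/negP => /andP [s_lt t_lt].
by move: g_le; rewrite leNgt expr2 ltr_pM.
Qed.

Theorem theorem18 (R : realType) (a : nat -> R) (n k : nat) :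
  (forall j, 0 <= a j) ->
  (1 <= k)%N -> (k <= n)%N ->
  forall A B : 'M[complex R]_n,
    hpd A -> hpd B ->
    (forall i, (1 <= i <= n)%N ->
       0 < lambda A i /\ ((lambda A i)%:E < conv_radius a)%E) ->
    (forall i, (1 <= i <= n)%N ->
       0 < lambda B i /\ ((lambda B i)%:E < conv_radius a)%E) ->
    phi k a (gmean A B) <= Num.sqrt (phi k a A * phi k a B).
Proof.
move=> a_ge0 k_gt0 le_kn A B A_pd B_pd A_radius B_radius.
have n_gt0 : (0 < n)%N := leq_trans k_gt0 le_kn.
(* [lambda] counts from 1 and [eigs] from 0; the product is shifted accordingly. *)
have phiE (X : 'M[complex R]_n) :
    phi k a X = \prod_(i < k) Defs.pseries a (nth 0 (eigs X) i).
  by rewrite /phi big_add1 big_mkord.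
have ltA i : (i < n)%N -> ((nth 0 (eigs A) i)%:E < conv_radius a)%E.
  by move=> lt_in; case: (A_radius i.+1).
have ltB i : (i < n)%N -> ((nth 0 (eigs B) i)%:E < conv_radius a)%E.
  by move=> lt_in; case: (B_radius i.+1).
have ltG i : (i < n)%N -> ((nth 0 (eigs (gmean A B)) i)%:E < conv_radius a)%E.
  move=> lt_in; apply: (@le_lt_trans _ _
      (Num.max (nth 0 (eigs A) 0) (nth 0 (eigs B) 0))%:E).
    by rewrite lee_fin gmean_eigs_le_max.
  by rewrite EFin_max gt_max ltA ?ltB.
(* Since [x <= |x|] and [|x|] is the square root of [x^2], the squared inequality suffices. *)
apply: le_trans (ler_norm _) _; rewrite -sqrtr_sqr; apply: ler_wsqrtr; rewrite !phiE.
apply: (pseries_prod_le a_ge0) => [i lt_ik|i lt_ik|i j /andP [le_ij lt_jk]|j le_jk].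
- have lt_in := leq_trans lt_ik le_kn.
  by split; [apply: gmean_eigs_gt0|apply: hpd_eigs_gt0|apply: hpd_eigs_gt0].
- have lt_in := leq_trans lt_ik le_kn.
  by split; [apply: ltG|apply: ltA|apply: ltB].
- apply: eigs_nonincreasing; first by case: (hpsd_gmean A_pd B_pd).
  by rewrite le_ij (leq_trans lt_jk le_kn).
- by apply: gmean_log_majorization => //; apply: leq_trans le_kn.
Qed.
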